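(* Let $(X,d,\mu)$ be a coarse median space which is geodesic and has rank $1$. Then for any $\zeta,\varepsilon>0$ there exists a constant $\widetilde D=\widetilde D(\zeta,\varepsilon)$ such that for any $a,b\in X$ and any $(\zeta,\varepsilon)$-quasi-geodesic $\gamma\colon[s,t]\to X$ with $\gamma(s)=a$, $\gamma(t)=b$, the Hausdorff distance between the interval $[a,b]$ and $\mathrm{Im}(\gamma)$ is less than $\widetilde D$.
   Context: Write $x\sim_s y$ if $d(x,y)\leqslant s$. A coarse median space is a triple $(X,d,\mu)$ with $(X,d)$ a metric space and $\mu\colon X^3\to X$ satisfying: (M1) $\mu(a,a,b)=a$; (M2) $\mu(a_1,a_2,a_3)$ is invariant under permutations of its arguments; (C1) there is an affine $\rho(t)=Kt+H_0$ with $d(\mu(a,b,c),\mu(a',b',c'))\leqslant\rho(d(a,a')+d(b,b')+d(c,c'))$ for all points; (C2) there is $H\colon\mathbb N\to[0,\infty)$ such that for every finite $A\subseteq X$ with $1\leqslant|A|\leqslant p$ there are a finite median algebra $(\Pi,\mu_\Pi)$ and maps $\pi\colon A\to\Pi$, $\lambda\colon\Pi\to X$ with $\lambda\mu_\Pi(x,y,z)\sim_{H(p)}\mu(\lambda x,\lambda y,\lambda z)$ for all $x,y,z\in\Pi$ and $\lambda\pi a\sim_{H(p)}a$ for all $a\in A$. (A median algebra is a set with a ternary operation $m$ satisfying $m(a,a,b)=a$, full symmetry, and $m(m(a,b,c),b,d)=m(a,b,m(c,b,d))$.) The rank of a median algebra is the supremum of $n$ such that it contains a subalgebra isomorphic to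 $I^n=(\mathbb Z_2)^n$ with coordinatewise majority vote as median. The coarse median space has rank at most $n$ if there exist $\rho,H$ as in (C1),(C2) for which $\Pi$ in (C2) can always be chosen of rank at most $n$; its rank is the least such $n$. The interval is $[a,b]=\{\mu(a,y,b):y\in X\}$. A map $\gamma\colon[s,t]\to X$ is a $(\zeta,\varepsilon)$-quasi-geodesic if $\zeta^{-1}|u-v|-\varepsilon\leqslant d(\gamma(u),\gamma(v))\leqslant\zeta|u-v|+\varepsilon$ for all $u,v\in[s,t]$. *)

(* Defs.v *)
From Stdlib Require Import Reals List.
From Coquelicot Require Import Coquelicot.
Import ListNotations.
Open Scope R_scope.

Definition is_metric {X : Type} (d : X -> X -> R) : Prop :=
  (forall x y, 0 <= d x y) /\
  (forall x y, d x y = 0 <-> x = y) /\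
  (forall x y, d x y = d y x) /\
  (forall x y z, d x z <= d x y + d y z).

Definition is_median_algebra {P : Type} (m : P -> P -> P -> P) : Prop :=
  (forall a b, m a a b = a) /\
  (forall a b c, m a b c = m a c b /\ m a b c = m b a c /\ m a b c = m b c a /\
                 m a b c = m c a b /\ m a b c = m c b a) /\
  (forall a b c e, m (m a b c) b e = m a b (m c b e)).

(** The cube I^k = (Z_2)^k, points = boolean lists of length k,
    median = coordinatewise majority vote. *)
Definition majb (x y z : bool) : bool := (x && y) || (y && z) || (x && z).

Fixpoint lmed (u v w : list bool) : list bool :=
  match u, v, w with
  | x :: u', y :: v', z :: w' => majb x y z :: lmed u' v' w'
  | _, _, _ => []
  end.

(** (P,m) contains a subalgebra isomorphic to I^k: an injective median
    homomorphism from I^k into P (its image is such a subalgebra). *)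
Definition embeds_cube {P : Type} (m : P -> P -> P -> P) (k : nat) : Prop :=
  exists f : list bool -> P,
    (forall u v, length u = k -> length v = k -> f u = f v -> u = v) /\
    (forall u v w, length u = k -> length v = k -> length w = k ->
       f (lmed u v w) = m (f u) (f v) (f w)).

Definition median_rank_le {P : Type} (m : P -> P -> P -> P) (n : nat) : Prop :=
  forall k, embeds_cube m k -> (k <= n)%nat.

(** Axiom (C2) with function H, where the finite median algebras are required
    to satisfy the extra property Q (used for rank bounds).  A finite subset
    A of X with 1 <= |A| <= p is given as a duplicate-free list. *)
Definition C2_with {X : Type} (d : X -> X -> R) (mu : X -> X -> X -> X)
    (H : nat -> R) (Q : forall P : Type, (P -> P -> P -> P) -> Prop) : Prop :=
  forall (p : nat) (A : list X), NoDup A -> (1 <= length A <= p)%nat ->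
    exists (P : Type) (m : P -> P -> P -> P) (enumP : list P),
      (forall x, In x enumP) /\ is_median_algebra m /\ Q P m /\
      exists (pi : X -> P) (lam : P -> X),
        (forall x y z, d (lam (m x y z)) (mu (lam x) (lam y) (lam z)) <= H p) /\
        (forall a, In a A -> d (lam (pi a)) a <= H p).

Definition coarse_median_with {X : Type} (d : X -> X -> R) (mu : X -> X -> X -> X)
    (Q : forall P : Type, (P -> P -> P -> P) -> Prop) : Prop :=
  is_metric d /\
  (forall a b, mu a a b = a) /\
  (forall a b c, mu a b c = mu a c b /\ mu a b c = mu b a c /\ mu a b c = mu b c a /\
                 mu a b c = mu c a b /\ mu a b c = mu c b a) /\
  exists (K H0 : R) (H : nat -> R),
    (forall a b c a' b' c',
       d (mu a b c) (mu a' b' c') <= K * (d a a' + d b b' + d c c') + H0) /\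
    (forall p, 0 <= H p) /\
    C2_with d mu H Q.

Definition coarse_median_space {X : Type} (d : X -> X -> R) (mu : X -> X -> X -> X) : Prop :=
  coarse_median_with d mu (fun _ _ => True).

Definition cms_rank_le {X : Type} (d : X -> X -> R) (mu : X -> X -> X -> X) (n : nat) : Prop :=
  coarse_median_with d mu (fun P m => median_rank_le m n).

Definition cms_rank_eq {X : Type} (d : X -> X -> R) (mu : X -> X -> X -> X) (n : nat) : Prop :=
  cms_rank_le d mu n /\ forall k, (k < n)%nat -> ~ cms_rank_le d mu k.

Definition geodesic {X : Type} (d : X -> X -> R) : Prop :=
  forall x y, exists g : R -> X, g 0 = x /\ g (d x y) = y /\
    forall u v, 0 <= u <= d x y -> 0 <= v <= d x y -> d (g u) (g v) = Rabs (u - v).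

Definition quasi_geodesic {X : Type} (d : X -> X -> R) (zeta eps : R)
    (gamma : R -> X) (s t : R) : Prop :=
  s <= t /\
  forall u v, s <= u <= t -> s <= v <= t ->
    / zeta * Rabs (u - v) - eps <= d (gamma u) (gamma v) /\
    d (gamma u) (gamma v) <= zeta * Rabs (u - v) + eps.

Definition cinterval {X : Type} (mu : X -> X -> X -> X) (a b : X) : X -> Prop :=
  fun x => exists y, x = mu a y b.

Definition image_on {X : Type} (gamma : R -> X) (s t : R) : X -> Prop :=
  fun x => exists u, s <= u <= t /\ x = gamma u.

Definition dist_pt_set {X : Type} (d : X -> X -> R) (x : X) (B : X -> Prop) : Rbar :=
  Glb_Rbar (fun r => exists b, B b /\ r = d x b).

Definition hausdorff_dist {X : Type} (d : X -> X -> R) (A B : X -> Prop) : Rbar :=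
  Lub_Rbar (fun r => (exists a, A a /\ Finite r = dist_pt_set d a B) \/
                     (exists b, B b /\ Finite r = dist_pt_set d b A)).

(* Main.v *)
(** In a median algebra without squares, two points [x], [y] whose projections
    [p = m a x b] and [m a y b] differ satisfy [m x p y = p], since otherwise
    these projections and their own projections to the interval between [x] and
    [y] are the corners of a square.  Transported through (C2) for the four
    points [a], [b], [x], [y], this says that [x |-> mu a x b] is a contracting
    projection: if [mu a x b] and [mu a y b] are far apart, then
    [d x (mu a x b)] is at most linear in [d x y].  Far from the interval,
    equal steps along a quasi-geodesic with large stride therefore advance
    faster than their projections do, so excursions are short.  Conversely, two
    points of the interval are coarsely comparable, so the projected
    quasi-geodesic cannot jump over any point of the interval. *)
Require Import Defs.
From Stdlib Require Import Reals List Lra Lia Classical.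
From Coquelicot Require Import Coquelicot.
Import ListNotations.
Open Scope R_scope.

(** * Betweenness and squares in median algebras *)

Definition between {P : Type} (m : P -> P -> P -> P) (u x v : P) : Prop :=
  m u x v = x.

Section MedianAlgebra.
Context {P : Type} {m : P -> P -> P -> P} (Hm : is_median_algebra m).

Lemma med_idem a b : m a a b = a.
Proof. apply Hm. Qed.

Lemma med_perm a b c :
  m a b c = m a c b /\ m a b c = m b a c /\ m a b c = m b c a /\
  m a b c = m c a b /\ m a b c = m c b a.
Proof. apply Hm. Qed.

Lemma med_assoc a b c e : m (m a b c) b e = m a b (m c b e).
Proof. apply Hm. Qed.

Ltac perm := first [reflexivity | apply med_perm].

Lemma med_idem_outer a b : m a b a = a.
Proof. replace (m a b a) with (m a a b) by perm; apply med_idem. Qed.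

Lemma med_idem_right a b : m a b b = b.
Proof. replace (m a b b) with (m b b a) by perm; apply med_idem. Qed.

Lemma between_sym u x v : between m u x v -> between m v x u.
Proof. unfold between; intros H; rewrite <- H at 2; perm. Qed.

Lemma between_refl_eq u x : between m u x u -> x = u.
Proof. unfold between; rewrite med_idem_outer; congruence. Qed.

Lemma between_med a x b : between m a (m a x b) b.
Proof.
  unfold between; replace (m a x b) with (m x b a) by perm.
  replace (m a (m x b a) b) with (m (m x b a) b a) by perm.
  now rewrite med_assoc, med_idem_outer.
Qed.

Lemma between_med_left a x b : between m a (m a x b) x.
Proof. replace (m a x b) with (m a b x) by perm; apply between_med. Qed.

Lemma between_med_right a x b : between m x (m a x b) b.
Proof. replace (m a x b) with (m x a b) by perm; apply between_med. Qed.

Lemma between_trans a v u b :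
  between m a v u -> between m a u b -> between m a v b.
Proof.
  unfold between; intros H1 H2.
  replace (m a v b) with (m (m v a u) a b).
  - rewrite med_assoc; replace (m u a b) with (m a u b) by perm.
    rewrite H2; rewrite <- H1 at 2; perm.
  - replace (m v a u) with (m a v u) by perm; rewrite H1; perm.
Qed.

(** Together with [between_trans], this lets [a], [v], [u], [b] be treated as four points in linear
    order. *)
Lemma between_shift a v u b :
  between m a v u -> between m a u b -> between m v u b.
Proof.
  unfold between; intros H1 H2.
  replace (m v u b) with (m (m v u a) u b).
  - rewrite med_assoc, H2; apply med_idem_right.
  - replace (m v u a) with (m a v u) by perm; now rewrite H1.
Qed.

Lemma between_meet z u v w :
  between m u z v -> between m u z w -> between m u z (m u v w).
Proof.
  unfold between; intros H1 H2.
  replace (m u z (m u v w)) with (m z u (m v u w)).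
  - rewrite <- med_assoc; replace (m z u v) with (m u z v) by perm.
    rewrite H1; rewrite <- H2 at 2; perm.
  - replace (m u v w) with (m v u w) by perm; perm.
Qed.

Lemma med_unique z u v w :
  between m u z v -> between m v z w -> between m u z w -> z = m u v w.
Proof.
  (* By [between_meet], [z] lies between [g] and [u] and between [g] and [v]. Since [m g u v = g],
     it then lies in the interval from [g] to itself. *)
  intros Huv Hvw Huw; set (g := m u v w).
  assert (Hu : between m g z u).
  { apply between_sym, between_meet; assumption. }
  assert (Hv : between m g z v).
  { apply between_sym; unfold g; replace (m u v w) with (m v u w) by perm.
    apply between_meet; [now apply between_sym | assumption]. }
  apply between_refl_eq.
  replace g with (m g u v) at 2; [now apply between_meet|].
  assert (Hg : between m u g v) by apply between_med_left.
  transitivity (m u g v); [perm | exact Hg].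
Qed.

(* [m a w b] is the gate of [w] in the interval between [a] and [b]. *)
Lemma gate a b w u : between m a u b -> between m w (m a w b) u.
Proof.
  intros Hu; set (q := m a w b); set (r := m w q u).
  assert (Hqwa : between m w q a) by apply between_sym, between_med_left.
  assert (Hqwb : between m w q b) by apply between_med_right.
  assert (Hrwq : between m w r q) by apply between_med_left.
  assert (Hqra : between m r q a) by exact (between_shift _ _ _ _ Hrwq Hqwa).
  assert (Hqrb : between m r q b) by exact (between_shift _ _ _ _ Hrwq Hqwb).
  (* [r] lies between [w] and [q], so it has the same projection [q] as [w]. Hence [r = q] will
     follow once [r] is between [a] and [b]. *)
  assert (Hq : q = m a r b).
  { apply med_unique; [now apply between_sym | assumption | apply between_med]. }
  assert (Hrqu : between m q r u) by apply between_med_right.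
  (* [e] lies between [a] and [u], hence between [a] and [b]. Proving [g = r] puts [r] between [e]
     and [b], hence between [a] and [b]. For this, [g] is between [r] and [e] and between [r] and
     [q], while [m r e q = r]. *)
  set (e := m u r a); set (g := m e r b).
  assert (Heau : between m a e u) by apply between_sym, between_med.
  assert (Heab : between m a e b) by exact (between_trans _ _ _ _ Heau Hu).
  assert (Hera : between m r e a) by apply between_med_right.
  assert (Hreq : between m e r q).
  { apply (between_shift u); [apply between_med_left | now apply between_sym]. }
  assert (Hgre : between m r g e) by apply between_sym, between_med_left.
  assert (Hgrq : between m r g q).
  { rewrite Hq; replace (m a r b) with (m r a b) by perm.
    apply between_meet; [exact (between_trans _ _ _ _ Hgre Hera)|].
    apply between_med_right. }
  assert (Hg : g = r).
  { apply between_refl_eq.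
    replace r with (m r e q) at 2; [now apply between_meet|].
    transitivity (m e r q); [perm | exact Hreq]. }
  assert (Hrbe : between m b r e).
  { apply between_sym; rewrite <- Hg; apply between_med. }
  assert (Hrab : between m a r b).
  { apply between_sym, (between_trans _ _ e); [assumption | now apply between_sym]. }
  unfold between; fold r; now rewrite Hq.
Qed.

(** Four points in cyclic order, each between its two neighbours, are closed under medians like the
    corners of $I^2$. If no side at [p] collapses, all four are distinct and rank 1 is violated. *)
Lemma rank1_square p q r s :
  median_rank_le m 1 ->
  between m s p q -> between m p q r -> between m q r s -> between m r s p ->
  p = q \/ p = s.
Proof.
  intros Hrank Hp Hq Hr Hs.
  destruct (classic (p = q)) as [|Hpq]; [now left|].
  destruct (classic (p = s)) as [|Hps]; [now right|].
  assert (Hqs : q <> s) by (intros <-; now apply Hpq, between_refl_eq).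
  assert (Hpr : p <> r) by (intros <-; now apply Hpq, eq_sym, between_refl_eq).
  assert (Hqr : q <> r).
  { intros <-; apply Hps.
    transitivity (m s p q); [symmetry; exact Hp|].
    transitivity (m q s p); [perm | exact Hs]. }
  assert (Hrs : r <> s).
  { intros <-; apply Hpq.
    transitivity (m r p q); [symmetry; exact Hp|].
    transitivity (m p q r); [perm | exact Hq]. }
  exfalso; enough (2 <= 1)%nat by lia.
  apply Hrank.
  (* Adjacent corners differ in one coordinate; [s] is the corner [[false; true]] and also the value
     on lists of other lengths. *)
  exists (fun l => match l with
                   | [false; false] => p
                   | [true; false] => q
                   | [true; true] => r
                   | _ => s
                   end).
  split.
  - intros u v Hu Hv.
    destruct u as [|[] [|[] [|]]]; try discriminate;
      destruct v as [|[] [|[] [|]]]; try discriminate; intros E;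
      solve [reflexivity | congruence].
  - intros u v w Hu Hv Hw.
    destruct u as [|[] [|[] [|]]]; try discriminate;
      destruct v as [|[] [|[] [|]]]; try discriminate;
      destruct w as [|[] [|[] [|]]]; try discriminate; cbn; symmetry;
      first [ apply med_idem | apply med_idem_outer
            | apply med_idem_right
            | (transitivity (m s p q); [perm | exact Hp]) | (transitivity (m p q r); [perm | exact Hq])
            | (transitivity (m q r s); [perm | exact Hr]) | (transitivity (m r s p); [perm | exact Hs]) ].
Qed.

(** The points [z], [w] and their medians with [a] and with [b] form a square, which must
    degenerate. *)
Lemma rank1_interval_linear a b z w :
  median_rank_le m 1 -> between m a z b -> between m a w b ->
  m a z w = z \/ m a z w = w.
Proof.
  intros Hrank Hz Hw; set (e := m a z w); set (f := m b z w).
  assert (Hcorner : forall u, between m a u b -> between m a (m a z w) u ->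
                    between m b (m b z w) u -> between m e u f).
  { intros u Hu He Hf; apply between_sym, (between_shift b); [exact Hf|].
    apply between_sym; exact (between_shift _ _ _ _ He Hu). }
  apply (rank1_square e z f w); [assumption | | | |].
  - apply between_sym, between_med_right.
  - apply Hcorner; [assumption | apply between_med_left | apply between_med_left].
  - apply between_med_right.
  - apply between_sym, Hcorner; [assumption | apply between_med | apply between_med].
Qed.

(* Otherwise [m a x b], [m a y b] and their gates between [x] and [y] are the
   corners of a square. *)
Lemma rank1_projections a b x y :
  median_rank_le m 1 ->
  m a x b = m a y b \/ m x (m a x b) y = m a x b.
Proof.
  intros Hrank; set (p := m a x b); set (q := m a y b).
  set (p' := m x p y); set (q' := m x q y).
  (* Points between [u] and its projection [c] project to [c] as well; [gate], applied to such a
     point, puts [c] between it and [v]. *)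
  assert (Hcorner : forall u v w, between m a v b ->
            between m v (m a u b) (m w (m a u b) u)).
  { intros u v w Hv; set (c := m a u b).
    assert (Hc : between m (m w c u) c a).
    { apply (between_shift u); [apply between_sym, between_med_right|].
      apply between_sym, between_med_left. }
    assert (Hc' : between m (m w c u) c b).
    { apply (between_shift u); [apply between_sym, between_med_right|].
      apply between_med_right. }
    replace c with (m a (m w c u) b) at 1.
    - apply between_sym, gate, Hv.
    - symmetry; apply med_unique;
        [now apply between_sym | assumption | apply between_med]. }
  destruct (rank1_square p q q' p') as [H|H]; auto.
  - replace p' with (m y p x) by (unfold p'; perm).
    apply between_sym, Hcorner, between_med.
  - apply Hcorner, between_med.
  - apply gate, between_med.
  - apply between_sym, gate, between_med.
Qed.
End MedianAlgebra.

(** * Extremal indices *)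

Lemma exists_last_true (Q : nat -> Prop) (k : nat) :
  Q 0%nat -> exists i, (i <= k)%nat /\ Q i /\ forall l, (i < l <= k)%nat -> ~ Q l.
Proof.
  intros H0; induction k as [|k [i [Hi [HQ Hl]]]].
  - exists 0%nat; repeat split; auto; intros; lia.
  - destruct (classic (Q (S k))) as [H|H].
    + exists (S k); repeat split; auto; intros; lia.
    + exists i; repeat split; auto; intros l Hl'.
      destruct (Nat.eq_dec l (S k)) as [->|]; auto; apply Hl; lia.
Qed.

Lemma exists_first_true (Q : nat -> Prop) (k n : nat) :
  Q (k + n)%nat ->
  exists j, (k <= j)%nat /\ Q j /\ forall l, (k <= l < j)%nat -> ~ Q l.
Proof.
  revert k; induction n as [|n IH]; intros k H.
  - exists k; rewrite Nat.add_0_r in H; repeat split; auto; intros; lia.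
  - destruct (classic (Q k)) as [Hk|Hk].
    + exists k; repeat split; auto; intros; lia.
    + destruct (IH (S k)) as [j [Hj [HQ Hl]]]; [now rewrite Nat.add_succ_comm|].
      exists j; repeat split; [lia | auto |]; intros l Hl'.
      destruct (Nat.eq_dec l k) as [->|]; auto; apply Hl; lia.
Qed.

(** * Excursions, sampling and Hausdorff distance in a metric space *)

Section Metric.
Context {X : Type} {d : X -> X -> R} (Hd : is_metric d).

Lemma dist_nonneg x y : 0 <= d x y.
Proof. apply Hd. Qed.

Lemma dist_refl x : d x x = 0.
Proof. now apply Hd. Qed.

Lemma dist_sym x y : d x y = d y x.
Proof. apply Hd. Qed.

Lemma dist_triangle y x z : d x z <= d x y + d y z.
Proof. apply Hd. Qed.

Lemma dist_chain (x : nat -> X) (c : R) (i n : nat) :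
  (forall l, (i <= l < i + n)%nat -> d (x l) (x (S l)) <= c) ->
  d (x i) (x (i + n)%nat) <= c * INR n.
Proof.
  induction n as [|n IH]; intros Hc.
  - rewrite Nat.add_0_r, dist_refl; simpl; lra.
  - rewrite S_INR, <- plus_n_Sm.
    pose proof (dist_triangle (x (i + n)%nat) (x i) (x (S (i + n)))).
    assert (d (x i) (x (i + n)%nat) <= c * INR n) by (apply IH; intros; apply Hc; lia).
    assert (d (x (i + n)%nat) (x (S (i + n))) <= c) by (apply Hc; lia).
    lra.
Qed.

(* While the sequence stays far from the image of [pr], its projection moves
   by at most [C1] per step whereas the sequence itself advances by [2 * C1],
   so an excursion has boundedly many steps. *)
Lemma contracting_excursion_bound (pr : X -> X) (x : nat -> X) (N : nat)
  (K H0 C1 C2 c eps : R) :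
  0 <= K -> 0 <= H0 -> 1 <= C1 -> 0 <= C2 -> 0 <= c -> 0 <= eps ->
  (forall y z, d (pr y) (pr z) <= K * d y z + H0) ->
  (forall y z, d (pr y) (pr z) <= C1 \/ d y (pr y) <= K * d y z + C2) ->
  (forall i, d (x i) (x (S i)) <= c) ->
  (forall i j, (i <= j)%nat -> pr (x j) <> x j ->
     2 * C1 * INR (j - i) - eps <= d (x i) (x (S j))) ->
  pr (x 0%nat) = x 0%nat -> pr (x N) = x N ->
  forall k, (k <= N)%nat ->
  let M := K * c + C2 in
  let B := 2 * M + K * c + H0 + eps in
  d (x k) (pr (x k)) <= c * B + M + (K * (c * B) + H0).
Proof.
  intros HK HH0 HC1 HC2 Hc Heps Hlip Hcontr Hstep Hprog Hx0 HxN k Hk M B.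
  assert (HKc : 0 <= K * c) by nra.
  assert (HM : 0 <= M) by (unfold M; lra).
  assert (HB : 0 <= B) by (unfold B; lra).
  assert (HcB : 0 <= c * B) by nra.
  assert (HKcB : 0 <= K * (c * B)) by nra.
  set (Q := fun i => d (x i) (pr (x i)) <= M).
  assert (HQ : forall i, pr (x i) = x i -> Q i).
  { intros i Hi; unfold Q; rewrite Hi, dist_refl; exact HM. }
  destruct (classic (Q k)) as [HQk|HQk]; [unfold Q in HQk; lra|].
  (* The excursion around [k] runs from the last near index [i] before [k] to the first near index
     after [k], renamed [S j] below. *)
  destruct (exists_last_true Q k (HQ _ Hx0)) as [i [Hik [HQi Hi]]].
  destruct (exists_first_true Q k (N - k)) as [j [Hkj [HQj Hj]]].
  { replace (k + (N - k))%nat with N by lia; auto. }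
  assert (Hne_i : i <> k) by (intros ->; auto).
  destruct j as [|j]; [assert (k = 0)%nat by lia; subst; contradiction|].
  assert (Hne_j : S j <> k) by (intros Hjk; rewrite Hjk in HQj; auto).
  assert (Hfar : forall l, (i < l <= j)%nat -> ~ Q l).
  { intros l Hl; destruct (Nat.le_gt_cases l k); [apply Hi | apply Hj]; lia. }
  (* Being farther than [M = K * c + C2] from the projection rules out the second alternative of
     [Hcontr]. The step from [i] starts near, so it is bounded by [Hlip] instead. *)
  assert (Hpr : d (pr (x (S i))) (pr (x (S j))) <= C1 * INR (j - i)).
  { replace (S j) with (S i + (j - i))%nat by lia.
    apply (dist_chain (fun l => pr (x l))); intros l Hl.
    destruct (Hcontr (x l) (x (S l))) as [H|H]; [exact H|].
    exfalso; apply (Hfar l); [lia|]; unfold Q, M.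
    specialize (Hstep l); nra. }
  assert (Hadv : 2 * C1 * INR (j - i) - eps <= d (x i) (x (S j))).
  { apply Hprog; [lia|]; intros H; apply (Hfar j); [lia | auto]. }
  (* The detour through the projections costs [M] at each end, [K * c + H0] for the first step and
     [C1] for each later one. Against the advance of [2 * C1] per step this leaves
     [C1 * INR (j - i) <= B]. *)
  assert (Hlen : INR (j - i) <= B).
  { assert (d (pr (x i)) (pr (x (S i))) <= K * c + H0).
    { pose proof (Hlip (x i) (x (S i))); specialize (Hstep i); nra. }
    pose proof (dist_triangle (pr (x i)) (x i) (x (S j))).
    pose proof (dist_triangle (pr (x (S i))) (pr (x i)) (x (S j))).
    pose proof (dist_triangle (pr (x (S j))) (pr (x (S i))) (x (S j))).
    rewrite (dist_sym (pr (x (S j)))) in *.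
    unfold Q in HQi, HQj; pose proof (pos_INR (j - i)); unfold B; nra. }
  assert (Hik' : d (x i) (x k) <= c * B).
  { replace k with (i + (k - i))%nat by lia.
    apply Rle_trans with (c * INR (k - i)); [now apply dist_chain|].
    assert (INR (k - i) <= INR (j - i)) by (apply le_INR; lia); nra. }
  pose proof (dist_triangle (x i) (x k) (pr (x k))).
  pose proof (dist_triangle (pr (x i)) (x i) (pr (x k))).
  pose proof (Hlip (x i) (x k)).
  rewrite (dist_sym (x k) (x i)) in *; unfold Q in HQi; nra.
Qed.

Lemma quasi_geodesic_sampling (zeta eps L : R) (gamma : R -> X) (s t : R) :
  0 < zeta -> 0 < L -> quasi_geodesic d zeta eps gamma s t ->
  exists (x : nat -> X) (N : nat),
    x 0%nat = gamma s /\ x N = gamma t /\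
    (forall i, image_on gamma s t (x i)) /\
    (forall i, d (x i) (x (S i)) <= zeta * L + eps) /\
    (forall i j, (i <= j)%nat -> x j <> gamma t ->
       / zeta * (INR (j - i) * L) - eps <= d (x i) (x (S j))) /\
    (forall u, s <= u <= t ->
       exists k, (k <= N)%nat /\ d (gamma u) (x k) <= zeta * L + eps).
Proof.
  intros Hz HL [Hst Hg].
  (* Truncation at [t] makes the sequence eventually constant. The step from [j] to [S j] may be cut
     short, so only [j - i] full strides are counted. *)
  set (u := fun i => Rmin (s + INR i * L) t).
  assert (Hu : forall i, s <= u i <= t).
  { intros i; pose proof (pos_INR i); split; [|apply Rmin_r].
    apply Rmin_glb; nra. }
  destruct (INR_unbounded ((t - s) / L)) as [N HN].
  assert (HNt : t <= s + INR N * L).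
  { apply Rmult_gt_compat_r with (r := L) in HN; [|lra].
    unfold Rdiv in HN; rewrite Rmult_assoc, Rinv_l, Rmult_1_r in HN; lra. }
  exists (fun i => gamma (u i)), N; repeat split.
  - unfold u; simpl; f_equal; rewrite Rmin_left; lra.
  - unfold u; f_equal; rewrite Rmin_right; lra.
  - intros i; exists (u i); auto.
  - intros i; destruct (Hg (u i) (u (S i))) as [_ H]; auto.
    assert (Rabs (u i - u (S i)) <= L); [|nra].
    unfold u; rewrite S_INR; apply Rabs_le; unfold Rmin.
    destruct (Rle_dec (s + INR i * L) t), (Rle_dec (s + (INR i + 1) * L) t); nra.
  - intros i j Hij Hj; destruct (Hg (u i) (u (S j))) as [H _]; auto.
    assert (Hjt : s + INR j * L < t).
    { apply Rnot_le_lt; intros Hle; apply Hj; unfold u.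
      now rewrite Rmin_right. }
    assert (INR (j - i) * L <= Rabs (u i - u (S j))).
    { rewrite minus_INR by exact Hij; apply le_INR in Hij.
      rewrite Rabs_minus_sym; eapply Rle_trans; [|apply Rle_abs].
      unfold u; rewrite S_INR, (Rmin_left (s + INR i * L)) by nra.
      unfold Rmin; destruct (Rle_dec (s + (INR j + 1) * L) t); nra. }
    assert (/ zeta * (INR (j - i) * L) <= / zeta * Rabs (u i - u (S j))).
    { apply Rmult_le_compat_l; [|assumption].
      left; now apply Rinv_0_lt_compat. }
    lra.
  - intros v Hv.
    destruct (exists_last_true (fun i => s + INR i * L <= v) N) as [k [Hk [Hkv Hl]]].
    { simpl; lra. }
    exists k; split; [assumption|].
    destruct (Hg v (u k)) as [_ H]; auto.
    assert (Rabs (v - u k) <= L); [|nra].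
    assert (v <= s + (INR k + 1) * L).
    { destruct (Nat.eq_dec k N) as [->|Hne]; [nra|].
      rewrite <- S_INR; left; apply Rnot_le_lt, Hl; lia. }
    unfold u; rewrite Rmin_left by lra; apply Rabs_le; nra.
Qed.

(** The supremum is only bounded by [D]; the added 1 makes the inequality strict. *)
Lemma hausdorff_dist_lt (A B : X -> Prop) (D : R) :
  (forall x, A x -> exists y, B y /\ d x y <= D) ->
  (forall y, B y -> exists x, A x /\ d y x <= D) ->
  Rbar_lt (hausdorff_dist d A B) (Finite (D + 1)).
Proof.
  intros HA HB.
  assert (Hpt : forall x (E : X -> Prop) r, (exists y, E y /\ d x y <= D) ->
                Finite r = dist_pt_set d x E -> r <= D).
  { intros x E r [y [Hy Hxy]] Hr; unfold dist_pt_set in Hr.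
    destruct (Glb_Rbar_correct (fun r => exists b, E b /\ r = d x b)) as [Hlb _].
    rewrite <- Hr in Hlb; specialize (Hlb (d x y)); simpl in Hlb.
    apply Rle_trans with (d x y); [apply Hlb; eauto | assumption]. }
  apply Rbar_le_lt_trans with (Finite D); [|simpl; lra].
  unfold hausdorff_dist; apply Lub_Rbar_correct.
  intros r [[a [Ha Hr]]|[b [Hb Hr]]]; simpl; eapply Hpt; eauto.
Qed.
End Metric.

(** * Rank-one approximation and coarse median spaces of rank one *)

Definition rank1_approximable {X : Type} (d : X -> X -> R)
    (mu : X -> X -> X -> X) (h : R) (n : nat) : Prop :=
  forall A : list X, (1 <= length A <= n)%nat ->
    exists (P : Type) (m : P -> P -> P -> P) (pi : X -> P) (lam : P -> X),
      is_median_algebra m /\ median_rank_le m 1 /\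
      (forall x y z, d (lam (m x y z)) (mu (lam x) (lam y) (lam z)) <= h) /\
      (forall a, In a A -> d (lam (pi a)) a <= h).

Lemma exists_nodup {X : Type} (A : list X) :
  exists B, NoDup B /\ (length B <= length A)%nat /\ forall a, In a A <-> In a B.
Proof.
  induction A as [|x A [B [HB [Hlen Hin]]]].
  - exists []; repeat split; auto; constructor.
  - destruct (classic (In x B)) as [Hx|Hx].
    + exists B; repeat split; [assumption | simpl; lia | |].
      * intros [<-|Ha]; [assumption | now apply Hin].
      * intros Ha; right; now apply Hin.
    + exists (x :: B); repeat split; [now constructor | simpl; lia | |];
        intros [Ha|Ha]; simpl; auto; right; now apply Hin.
Qed.

(** Allowing repetitions lets lists such as [[a; b; x; y]] be used without asking which entries
    coincide; (C2) is applied after removing duplicates. *)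
Lemma cms_rank1_approximable {X : Type} {d : X -> X -> R} {mu : X -> X -> X -> X}
  {H : nat -> R} (n : nat) :
  C2_with d mu H (fun P m => median_rank_le m 1) ->
  rank1_approximable d mu (H n) n.
Proof.
  intros HC2 A HA; destruct (exists_nodup A) as [B [HB [Hlen Hin]]].
  destruct (HC2 n B HB) as (P & m & _ & _ & Hm & Hr & pi & lam & Hlam & Hpi).
  - destruct A as [|x A], B as [|y B]; simpl in *; try lia.
    exfalso; apply (Hin x); now left.
  - exists P, m, pi, lam; repeat split; auto; try apply Hm.
    intros a Ha; now apply Hpi, Hin.
Qed.

Section CoarseMedianRankOne.
Context {X : Type} {d : X -> X -> R} (Hd : is_metric d) {mu : X -> X -> X -> X}.
Context (mu_idem : forall a b, mu a a b = a).
Context (mu_perm : forall a b c,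
  mu a b c = mu a c b /\ mu a b c = mu b a c /\ mu a b c = mu b c a /\
  mu a b c = mu c a b /\ mu a b c = mu c b a).
Context {K H0 h : R} (HK : 0 <= K) (HH0 : 0 <= H0) (Hh : 0 <= h).
Context (mu_lip : forall a b c a' b' c',
  d (mu a b c) (mu a' b' c') <= K * (d a a' + d b b' + d c c') + H0).
Context (Happrox : rank1_approximable d mu h 4).

Lemma mu_idem_outer a b : mu a b a = a.
Proof. rewrite (proj1 (mu_perm a b a)); apply mu_idem. Qed.

Lemma proj_lip a b y z : d (mu a y b) (mu a z b) <= K * d y z + H0.
Proof.
  pose proof (mu_lip a y b a z b) as H; rewrite !(dist_refl Hd) in H; lra.
Qed.

Lemma approx_median {P : Type} {m : P -> P -> P -> P} {lam : P -> X} :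
  (forall x y z, d (lam (m x y z)) (mu (lam x) (lam y) (lam z)) <= h) ->
  forall u v w x y z alpha beta gamma,
    d (lam u) x <= alpha -> d (lam v) y <= beta -> d (lam w) z <= gamma ->
    d (lam (m u v w)) (mu x y z) <= h + (K * (alpha + beta + gamma) + H0).
Proof.
  intros Hlam u v w x y z al be ga Hx Hy Hz.
  pose proof (dist_triangle Hd (mu (lam u) (lam v) (lam w)) (lam (m u v w)) (mu x y z)).
  pose proof (mu_lip (lam u) (lam v) (lam w) x y z); specialize (Hlam u v w).
  nra.
Qed.

Lemma approx_close {P : Type} {lam : P -> X} {u v : P} {x y : X} {alpha beta : R} :
  u = v -> d (lam u) x <= alpha -> d (lam v) y <= beta -> d x y <= alpha + beta.
Proof.
  intros <- Hx Hy; pose proof (dist_triangle Hd (lam u) x y).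
  rewrite (dist_sym Hd x (lam u)) in *; lra.
Qed.

Lemma projection_contracting :
  exists C1 C2, 1 <= C1 /\ 0 <= C2 /\
    forall a b x y, d (mu a x b) (mu a y b) <= C1 \/
                    d x (mu a x b) <= K * d x y + C2.
Proof.
  (* [E1] is the error of a median of approximated points, [E2] that of a median with one such
     median as an argument. *)
  set (E1 := h + (K * (h + h + h) + H0)).
  set (E2 := h + (K * (h + E1 + h) + H0)).
  assert (0 <= E1) by (unfold E1; nra).
  assert (0 <= E2) by (unfold E2; nra).
  exists (1 + (E1 + E1)), (H0 + (E1 + E2)); split; [lra|]; split; [lra|].
  intros a b x y.
  destruct (Happrox [a; b; x; y]) as (P & m & pi & lam & Hm & Hr & Hlam & Hpi);
    [simpl; lia|].
  assert (Ha := Hpi a ltac:(simpl; tauto)); assert (Hb := Hpi b ltac:(simpl; tauto)).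
  assert (Hx := Hpi x ltac:(simpl; tauto)); assert (Hy := Hpi y ltac:(simpl; tauto)).
  pose proof (approx_median Hlam _ _ _ _ _ _ _ _ _ Ha Hx Hb) as Hp.
  pose proof (approx_median Hlam _ _ _ _ _ _ _ _ _ Ha Hy Hb) as Hq.
  destruct (rank1_projections Hm (pi a) (pi b) (pi x) (pi y) Hr) as [E|E].
  - left; pose proof (approx_close E Hp Hq); unfold E1; lra.
  - right.
    pose proof (approx_median Hlam _ _ _ _ _ _ _ _ _ Hx Hp Hy) as Hp'.
    pose proof (approx_close (eq_sym E) Hp Hp') as Hpp'.
    fold E1 in Hpp'; fold E2 in Hpp'.
    (* Replacing [y] by [x] in [mu x (mu a x b) y] gives [x] itself, at cost [K * d x y + H0]. *)
    pose proof (mu_lip x (mu a x b) x x (mu a x b) y) as Hlip.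
    rewrite mu_idem_outer, !(dist_refl Hd) in Hlip.
    pose proof (dist_triangle Hd (mu x (mu a x b) y) x (mu a x b)).
    rewrite (dist_sym Hd (mu x _ y)) in *; lra.
Qed.

Lemma interval_coarsely_linear :
  exists C, 0 <= C /\ forall a b y v,
    let z := mu a y b in let w := mu a v b in
    d z (mu a z b) <= C /\ (d z (mu a z w) <= C \/ d w (mu a z w) <= C).
Proof.
  set (E1 := h + (K * (h + h + h) + H0)).
  set (E2 := h + (K * (h + E1 + h) + H0)).
  set (E3 := h + (K * (h + E1 + E1) + H0)).
  assert (0 <= E1) by (unfold E1; nra).
  assert (0 <= E2) by (unfold E2; nra).
  assert (0 <= E3) by (unfold E3; nra).
  exists (E1 + E2 + E3); split; [lra|]; intros a b y v z w.
  destruct (Happrox [a; b; y; v]) as (P & m & pi & lam & Hm & Hr & Hlam & Hpi);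
    [simpl; lia|].
  assert (Ha := Hpi a ltac:(simpl; tauto)); assert (Hb := Hpi b ltac:(simpl; tauto)).
  assert (Hy := Hpi y ltac:(simpl; tauto)); assert (Hv := Hpi v ltac:(simpl; tauto)).
  pose proof (approx_median Hlam _ _ _ _ _ _ _ _ _ Ha Hy Hb) as Hz.
  pose proof (approx_median Hlam _ _ _ _ _ _ _ _ _ Ha Hv Hb) as Hw.
  pose proof (approx_median Hlam _ _ _ _ _ _ _ _ _ Ha Hz Hb) as Hzb.
  pose proof (approx_median Hlam _ _ _ _ _ _ _ _ _ Ha Hz Hw) as Hzw.
  fold z w E1 E2 E3 in Hz, Hw, Hzb, Hzw.
  split.
  - pose proof (approx_close (eq_sym (between_med Hm _ _ _)) Hz Hzb); lra.
  - destruct (rank1_interval_linear Hm (pi a) (pi b) _ _ Hr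
                (between_med Hm _ (pi y) _) (between_med Hm _ (pi v) _)) as [E|E].
    + left; pose proof (approx_close (eq_sym E) Hz Hzw); lra.
    + right; pose proof (approx_close (eq_sym E) Hw Hzw); lra.
Qed.

(* By coarse linearity, a chain of projections running from [a] to [b] in small
   steps cannot jump over a point of the interval. *)
Lemma interval_near_projected_chain (c D : R) :
  0 <= c ->
  exists E, forall (a b : X) (x : nat -> X) (N : nat),
    x 0%nat = a -> x N = b ->
    (forall i, d (x i) (x (S i)) <= c) ->
    (forall i, (i <= N)%nat -> d (x i) (mu a (x i) b) <= D) ->
    forall z, cinterval mu a b z -> exists i, (i <= N)%nat /\ d z (x i) <= E.
Proof.
  intros Hc; destruct interval_coarsely_linear as [C [HC Hlin]].
  exists (2 * C + K * (K * c + H0) + H0 + Rabs D).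
  intros a b x N Hx0 HxN Hstep Hnear z [y ->].
  set (z := mu a y b); set (w := fun i => mu a (x i) b).
  assert (HKc : 0 <= K * c) by nra.
  assert (HKKc : 0 <= K * (K * c + H0)) by nra.
  pose proof (Rle_abs D) as HD.
  (* [i] is the last index with [w i] coarsely between [a] and [z]. By linearity [z] is then
     coarsely between [a] and [w (S i)], and since [w i] and [w (S i)] are close, [z] is close to
     [w i]. If [i = N], then [w N = b] is itself close to [z]. *)
  destruct (exists_last_true (fun i => d (w i) (mu a z (w i)) <= C) N)
    as [i [Hi [Hwi Hl]]].
  { unfold w; rewrite Hx0, mu_idem, mu_idem_outer, (dist_refl Hd); lra. }
  exists i; split; [assumption|].
  destruct (Nat.eq_dec i N) as [->|Hne].
  - assert (Hwb : w N = b).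
    { unfold w; rewrite HxN, (proj1 (proj2 (proj2 (mu_perm a b b)))); apply mu_idem. }
    rewrite Hwb in Hwi; rewrite HxN.
    destruct (Hlin a b y y) as [Hzb _]; fold z in Hzb.
    pose proof (dist_triangle Hd (mu a z b) z b).
    rewrite (dist_sym Hd b) in *; pose proof (Rabs_pos D); lra.
  - assert (Hz : d z (mu a z (w (S i))) <= C).
    { destruct (Hlin a b y (x (S i))) as [_ [H|H]]; [exact H|].
      exfalso; apply (Hl (S i)); [lia | exact H]. }
    assert (Hw : d (w i) (w (S i)) <= K * c + H0).
    { unfold w; pose proof (proj_lip a b (x i) (x (S i))); specialize (Hstep i); nra. }
    pose proof (mu_lip a z (w (S i)) a z (w i)) as Hmu.
    rewrite !(dist_refl Hd), (dist_sym Hd (w (S i))) in Hmu.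
    assert (K * d (w i) (w (S i)) <= K * (K * c + H0)) by nra.
    pose proof (dist_triangle Hd (mu a z (w (S i))) z (x i)).
    pose proof (dist_triangle Hd (mu a z (w i)) (mu a z (w (S i))) (x i)).
    pose proof (dist_triangle Hd (w i) (mu a z (w i)) (x i)).
    specialize (Hnear i Hi); fold (w i) in Hnear.
    rewrite (dist_sym Hd (mu a z (w i)) (w i)), (dist_sym Hd (w i) (x i)) in *.
    lra.
Qed.

Lemma quasi_geodesic_near_interval (zeta eps : R) :
  0 < zeta -> 0 < eps ->
  exists D, forall (a b : X) (gamma : R -> X) (s t : R),
    quasi_geodesic d zeta eps gamma s t -> gamma s = a -> gamma t = b ->
    (forall z, cinterval mu a b z -> exists y, image_on gamma s t y /\ d z y <= D) /\
    (forall y, image_on gamma s t y -> exists z, cinterval mu a b z /\ d y z <= D).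
Proof.
  intros Hz He; destruct projection_contracting as (C1 & C2 & HC1 & HC2 & Hcontr).
  (* With this stride the lower quasi-geodesic bound gives an advance of [2 * C1] per step, twice
     the drift of the projection. *)
  set (L := 2 * zeta * C1); set (c := zeta * L + eps).
  assert (HL : 0 < L) by (unfold L; nra).
  assert (Hc : 0 <= c) by (unfold c; nra).
  set (M := K * c + C2); set (B := 2 * M + K * c + H0 + eps).
  set (D0 := c * B + M + (K * (c * B) + H0)).
  destruct (interval_near_projected_chain c D0 Hc) as [E HE].
  exists (Rmax E (c + D0)); intros a b gamma s t Hg Hs Ht.
  destruct (quasi_geodesic_sampling zeta eps L gamma s t Hz HL Hg)
    as (x & N & Hx0 & HxN & Him & Hstep & Hprog & Hcover).
  rewrite Hs in Hx0; rewrite Ht in HxN.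
  assert (Hpa : mu a a b = a) by apply mu_idem.
  assert (Hpb : mu a b b = b).
  { rewrite (proj1 (proj2 (proj2 (mu_perm a b b)))); apply mu_idem. }
  assert (Hfar : forall k, (k <= N)%nat -> d (x k) (mu a (x k) b) <= D0).
  { apply (contracting_excursion_bound Hd (fun y => mu a y b) x N K H0 C1 C2 c eps);
      auto; try lra; try congruence.
    - intros; apply proj_lip.
    (* The projection fixes [b], so a sample moved by it is not the endpoint [gamma t]. *)
    - intros i j Hij Hj; eapply Rle_trans; [|apply Hprog; [exact Hij|congruence]].
      right; unfold L; field; lra. }
  split.
  - intros z Hzi; destruct (HE a b x N Hx0 HxN Hstep Hfar z Hzi) as [i [_ Hi]].
    exists (x i); split; [apply Him|].
    eapply Rle_trans; [exact Hi | apply Rmax_l].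
  - intros y [u [Hu ->]]; destruct (Hcover u Hu) as [k [Hk Hd']].
    exists (mu a (x k) b); split; [now exists (x k)|].
    pose proof (dist_triangle Hd (x k) (gamma u) (mu a (x k) b)).
    specialize (Hfar k Hk); pose proof (Rmax_r E (c + D0)).
    fold c in Hd'; lra.
Qed.
End CoarseMedianRankOne.

Theorem theorem4p2 (X : Type) (d : X -> X -> R) (mu : X -> X -> X -> X) :
  coarse_median_space d mu -> geodesic d -> cms_rank_eq d mu 1 ->
  forall zeta eps : R, 0 < zeta -> 0 < eps ->
  exists Dt : R,
    forall (a b : X) (gamma : R -> X) (s t : R),
      quasi_geodesic d zeta eps gamma s t -> gamma s = a -> gamma t = b ->
      Rbar_lt (hausdorff_dist d (cinterval mu a b) (image_on gamma s t)) (Finite Dt).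
Proof.
  intros _ _ [(Hd & Hidem & Hperm & K & H0 & H & Hlip & HH & HC2) _] zeta eps Hz He.
  (* Absolute values make the constants of (C1) nonnegative. (C2) is taken for four points, with
     error [H 4]. *)
  destruct (quasi_geodesic_near_interval Hd Hidem Hperm (K := Rabs K) (H0 := Rabs H0)
              (Rabs_pos _) (Rabs_pos _) (HH 4%nat)) with (zeta := zeta) (eps := eps)
    as [D HD]; auto using cms_rank1_approximable.
  - intros a b c a' b' c'; eapply Rle_trans; [apply Hlip|].
    apply Rplus_le_compat; [|apply Rle_abs].
    apply Rmult_le_compat_r; [|apply Rle_abs].
    pose proof (dist_nonneg Hd a a'); pose proof (dist_nonneg Hd b b').
    pose proof (dist_nonneg Hd c c'); lra.
  - exists (D + 1); intros a b gamma s t Hg Hs Ht.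
    destruct (HD a b gamma s t Hg Hs Ht); now apply hausdorff_dist_lt.
Qed.
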